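(* Let $R>0$ and let $A\subset\mathbb{R}^2$ be an $R$-body such that, for every $a\in\partial A$, the set $\mathcal{N}_R(A,a)\subset S^1$ is spherically convex. Then $\mathrm{reach}(A)\ge R$.
   Context: A body is a nonempty closed subset of $\mathbb{R}^2$; $S^1$ is the unit circle; $B(x)=\{y:|y-x|<R\}$; $co(\cdot)$ convex hull. A body $A$ is an $R$-body if every $y\notin A$ lies in some open disk of radius $R$ disjoint from $A$. For $a\in\partial A$, $\mathcal{N}_R(A,a)=\{v\in S^1: A\cap B(a+Rv)=\emptyset\}$. A set $\mathcal K\subset S^1$ is spherically convex if $co(K)\cap S^1=\mathcal K$, where $K=\{\lambda v:\lambda\ge0,v\in\mathcal K\}$. $\mathrm{Unp}(A)$ is the set of points with a unique nearest point in $A$; $\mathrm{reach}(A,a)=\sup\{\rho>0:\{x:|x-a|<\rho\}\subset\mathrm{Unp}(A)\}$, $\mathrm{reach}(A)=\inf_{a\in A}\mathrm{reach}(A,a)$. *)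

(* Defs.v *)
From Stdlib Require Import Reals.
From Coquelicot Require Import Rbar Lub.
Open Scope R_scope.

Definition pt := (R * R)%type.

Definition padd (p q : pt) : pt := (fst p + fst q, snd p + snd q).
Definition pscale (l : R) (p : pt) : pt := (l * fst p, l * snd p).
Definition dist2 (p q : pt) : R :=
  sqrt ((fst p - fst q) ^ 2 + (snd p - snd q) ^ 2).
Definition origin : pt := (0, 0).

Definition disk (r : R) (x : pt) (y : pt) : Prop := dist2 y x < r.

Definition S1 (v : pt) : Prop := dist2 v origin = 1.

Definition closed_set (A : pt -> Prop) : Prop :=
  forall y, ~ A y -> exists e, 0 < e /\ forall z, disk e y z -> ~ A z.

Definition is_body (A : pt -> Prop) : Prop :=
  (exists a, A a) /\ closed_set A.

Definition boundary (A : pt -> Prop) (x : pt) : Prop :=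
  forall e, 0 < e -> (exists y, disk e x y /\ A y) /\ (exists y, disk e x y /\ ~ A y).

Definition is_R_body (r : R) (A : pt -> Prop) : Prop :=
  is_body A /\
  forall y, ~ A y -> exists c, disk r c y /\ forall z, disk r c z -> ~ A z.

Definition normal_cone_R (r : R) (A : pt -> Prop) (a : pt) (v : pt) : Prop :=
  S1 v /\ forall z, disk r (padd a (pscale r v)) z -> ~ A z.

Definition convex (C : pt -> Prop) : Prop :=
  forall p q t, C p -> C q -> 0 <= t <= 1 ->
    C (padd (pscale t p) (pscale (1 - t) q)).

Definition conv_hull (K : pt -> Prop) (x : pt) : Prop :=
  forall C, convex C -> (forall y, K y -> C y) -> C x.

Definition cone_of (Kc : pt -> Prop) (x : pt) : Prop :=
  exists l v, 0 <= l /\ Kc v /\ x = pscale l v.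

Definition sph_convex (Kc : pt -> Prop) : Prop :=
  forall v, (conv_hull (cone_of Kc) v /\ S1 v) <-> Kc v.

Definition nearest (A : pt -> Prop) (x a : pt) : Prop :=
  A a /\ forall b, A b -> dist2 x a <= dist2 x b.

Definition Unp (A : pt -> Prop) (x : pt) : Prop :=
  exists a, nearest A x a /\ forall b, nearest A x b -> b = a.

Definition reach_at (A : pt -> Prop) (a : pt) : Rbar :=
  Lub_Rbar (fun rho => 0 < rho /\ forall x, disk rho a x -> Unp A x).

Definition reach (A : pt -> Prop) : Rbar :=
  Rbar_glb (fun s => exists a, A a /\ s = reach_at A a).

(* Main.v *)
Require Import Defs.
From Stdlib Require Import Reals Lra Lia Psatz Classical IndefiniteDescription.
From Coquelicot Require Import Rcomplements Rbar Lub Lim_seq Hierarchy.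
Open Scope R_scope.

(** If [x] has distance [d < r] to [A] and [a] is a nearest point, then the disk of radius [d]
around [x] misses [A], i.e. the unit vector [v] from [a] to [x] satisfies
[2 d v.(z - a) <= |z - a|^2] on [A]. If the same holds with [r] in place of [d], i.e. if [v]
is in the [r]-normal cone, then [a] is the only nearest point.

To see that [v] is in the cone, let [u] be a unit vector with [u.v > 0]. The points [a + t u],
for small [t > 0], are outside [A], hence in free disks of radius [r]; these accumulate, as
[t -> 0], at a free disk touching [a], whose direction [w] is in the cone and has [w.u >= 0].
In fact [w.u > 0] can be achieved: if [w.u = 0], then [w] tilted slightly towards [u] is
again in the cone. Otherwise the lunes between the tilted disks and the limit disk contain
points of [A]; these can accumulate neither at [a] (a neighbourhood on the side of [u] is
covered by the disks in directions [v] and [w]), nor at an interior point of the bounding half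
circle (swallowed by the free disks), nor at the antipode [a + 2 r w] (there the tilted disk
is inside the free disk). Since the cone is convex, a vector [v] outside it would be separated
from it by some [u], which contradicts [w.u > 0]. *)


(** * Squared distances, limits and compactness in the plane *)

Definition sqd (p q : pt) : R := (fst p - fst q) ^ 2 + (snd p - snd q) ^ 2.
Definition dot (p q : pt) : R := fst p * fst q + snd p * snd q.
Definition shift (a p : pt) : pt := (fst p - fst a, snd p - snd a).

Ltac lim :=
  lazymatch goal with
  | |- is_lim_seq (fun n => _ + _) _ => eapply is_lim_seq_plus'; lim
  | |- is_lim_seq (fun n => _ - _) _ => eapply is_lim_seq_minus'; lim
  | |- is_lim_seq (fun n => _ * _) _ => eapply is_lim_seq_mult'; lim
  | |- _ => try first [apply is_lim_seq_const | eassumption]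
  end.

Lemma lim_le (u v : nat -> R) (l m : R) :
  is_lim_seq u l -> is_lim_seq v m -> (forall n, u n <= v n) -> l <= m.
Proof. intros Hu Hv H; exact (is_lim_seq_le u v l m H Hu Hv). Qed.

(** Lets [lim] compute a limit as an expression, which [ring] then identifies with the stated
    value. *)
Lemma lim_eq (u : nat -> R) (l m : R) : is_lim_seq u l -> l = m -> is_lim_seq u m.
Proof. now intros H <-. Qed.

Lemma sqd_ge0 (p q : pt) : 0 <= sqd p q.
Proof.
  unfold sqd; pose proof (pow2_ge_0 (fst p - fst q)).
  pose proof (pow2_ge_0 (snd p - snd q)); lra.
Qed.

Lemma dist2_sqd_lt (p q : pt) (r : R) : 0 < r -> dist2 p q < r <-> sqd p q < r ^ 2.
Proof.
  intros Hr; unfold dist2; fold (sqd p q).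
  pose proof (sqd_ge0 p q) as H0; pose proof (sqrt_pos (sqd p q)) as H1.
  pose proof (sqrt_sqrt _ H0) as H2; split; nra.
Qed.

Lemma dist2_sqd_le (p q p' q' : pt) : dist2 p q <= dist2 p' q' <-> sqd p q <= sqd p' q'.
Proof.
  unfold dist2; fold (sqd p q) (sqd p' q'); split; intros H.
  - now apply sqrt_le_0; try apply sqd_ge0.
  - now apply sqrt_le_1; try apply sqd_ge0.
Qed.

(** The condition [n <= phi n] already sends [phi] to infinity, and choice yields such a [phi]
    directly from a cluster point. *)
Lemma subseq_lim (u : nat -> R) (phi : nat -> nat) (l : R) :
  (forall n, (n <= phi n)%nat) -> is_lim_seq u l -> is_lim_seq (fun n => u (phi n)) l.
Proof.
  intros Hphi Hu; apply (is_lim_seq_subseq u l phi); [|exact Hu].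
  intros P [N HN]; exists N; intros n Hn; apply HN; specialize (Hphi n); lia.
Qed.

Lemma lim_inv_S : is_lim_seq (fun n => / (INR n + 1)) 0.
Proof.
  apply is_lim_seq_spec; intros e.
  destruct (archimed_cor1 e (cond_pos e)) as [N [HN HN0]].
  exists N; intros n Hn.
  pose proof (lt_0_INR _ HN0); pose proof (le_INR _ _ Hn).
  assert (0 < / (INR n + 1)) by (apply Rinv_0_lt_compat; lra).
  assert (/ (INR n + 1) <= / INR N) by (apply Rinv_le_contravar; lra).
  rewrite Rminus_0_r, Rabs_pos_eq; lra.
Qed.

Lemma lim_of_inv_S_bound (u : nat -> R) (l : R) :
  (forall n, Rabs (u n - l) <= / (INR n + 1)) -> is_lim_seq u l.
Proof.
  intros H.
  apply (is_lim_seq_le_le (fun n => l - / (INR n + 1)) u (fun n => l + / (INR n + 1))).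
  - intros n; specialize (H n); apply Rabs_le_between in H; lra.
  - eapply lim_eq; [lim; apply lim_inv_S | ring].
  - eapply lim_eq; [lim; apply lim_inv_S | ring].
Qed.

Lemma bounded_subseq (u : nat -> R) (M : R) :
  (forall n, Rabs (u n) <= M) ->
  exists (phi : nat -> nat) (l : R),
    (forall n, (n <= phi n)%nat) /\ is_lim_seq (fun n => u (phi n)) l.
Proof.
  intros HM.
  destruct (Bolzano_Weierstrass u (fun x => - M <= x <= M)) as [l Hl].
  - apply compact_P3.
  - intros n; apply Rabs_le_between, HM.
  - assert (Hc : forall n, exists p, (n <= p)%nat /\ Rabs (u p - l) <= / (INR n + 1)).
    { intros n.
      assert (He : 0 < / (INR n + 1)).
      { apply Rinv_0_lt_compat; pose proof (pos_INR n); lra. }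
      destruct (Hl (disc l (mkposreal _ He)) n) as [p [Hp Hd]].
      { exists (mkposreal _ He); intros x Hx; exact Hx. }
      exists p; split; [exact Hp|]; unfold disc in Hd; simpl in Hd; lra. }
    apply functional_choice in Hc; destruct Hc as [phi Hphi].
    exists phi, l; split; [intros n; apply Hphi|].
    apply lim_of_inv_S_bound; intros n; apply Hphi.
Qed.

Lemma bounded_subseq_pt (u : nat -> pt) (M : R) :
  (forall n, Rabs (fst (u n)) <= M /\ Rabs (snd (u n)) <= M) ->
  exists (phi : nat -> nat) (l : pt),
    (forall n, (n <= phi n)%nat) /\
    is_lim_seq (fun n => fst (u (phi n))) (fst l) /\
    is_lim_seq (fun n => snd (u (phi n))) (snd l).
Proof.
  intros HM.
  destruct (bounded_subseq (fun n => fst (u n)) M) as [f [l1 [Hf Hl1]]]; [apply HM|].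
  destruct (bounded_subseq (fun n => snd (u (f n))) M) as [g [l2 [Hg Hl2]]];
    [intros n; apply HM|].
  exists (fun n => f (g n)), (l1, l2); repeat split.
  - intros n; specialize (Hg n); specialize (Hf (g n)); lia.
  - exact (subseq_lim (fun n => fst (u (f n))) g l1 Hg Hl1).
  - exact Hl2.
Qed.

(** Applied to [A], to its copy in a rotated frame, and to the set of supporting directions. *)
Definition seq_closed (A : pt -> Prop) : Prop :=
  forall (u : nat -> pt) (l : pt), (forall n, A (u n)) ->
  is_lim_seq (fun n => fst (u n)) (fst l) ->
  is_lim_seq (fun n => snd (u n)) (snd l) -> A l.

Lemma closed_seq_closed (A : pt -> Prop) : Defs.closed_set A -> seq_closed A.
Proof.
  intros HA u l Hu H1 H2; apply NNPP; intros Hl.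
  destruct (HA l Hl) as [e [He Hd]].
  assert (H : is_lim_seq (fun n => sqd (u n) l) 0).
  { unfold sqd; simpl; eapply lim_eq; [lim | ring]. }
  assert (e ^ 2 <= 0); [|nra].
  apply (lim_le (fun _ => e ^ 2) (fun n => sqd (u n) l)); [lim|exact H|].
  intros n; apply Rnot_lt_le; intros Hlt.
  apply (Hd (u n)); [|apply Hu].
  now apply dist2_sqd_lt.
Qed.

Lemma Rabs_le_of_sqr (x y K : R) : (x - y) ^ 2 <= K -> Rabs y <= Rabs x + K + 1.
Proof.
  intros H; pose proof (Rabs_triang x (- (x - y))) as Ht.
  replace (x + - (x - y)) with y in Ht by ring.
  rewrite Rabs_Ropp in Ht; rewrite <- pow2_abs in H.
  pose proof (pow2_ge_0 (Rabs (x - y) - 1)); pose proof (Rabs_pos (x - y)); lra.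
Qed.

Lemma coord_bound_of_sqd (p q : pt) (K : R) :
  sqd p q <= K ->
  Rabs (fst q) <= Rabs (fst p) + Rabs (snd p) + K + 1 /\
  Rabs (snd q) <= Rabs (fst p) + Rabs (snd p) + K + 1.
Proof.
  unfold sqd; intros H.
  pose proof (pow2_ge_0 (fst p - fst q)); pose proof (pow2_ge_0 (snd p - snd q)).
  pose proof (Rabs_pos (fst p)); pose proof (Rabs_pos (snd p)).
  assert (Rabs (fst q) <= Rabs (fst p) + K + 1) by (apply Rabs_le_of_sqr; lra).
  assert (Rabs (snd q) <= Rabs (snd p) + K + 1) by (apply Rabs_le_of_sqr; lra).
  split; lra.
Qed.

Lemma nearest_exists (A : pt -> Prop) (x : pt) :
  (exists a, A a) -> seq_closed A ->
  exists a, A a /\ forall b, A b -> sqd x a <= sqd x b.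
Proof.
  intros [a0 Ha0] HA.
  (* Signs are reversed because [completeness] supplies suprema: [- m] is the infimum of the squared
     distances. *)
  destruct (completeness (fun s => exists b, A b /\ s = - sqd x b)) as [m [Hub Hlub]].
  - exists 0; intros s [b [_ ->]]; pose proof (sqd_ge0 x b); lra.
  - exists (- sqd x a0), a0; auto.
  - assert (Hc : forall n : nat, exists b, A b /\ sqd x b <= - m + / (INR n + 1)).
    { intros n; apply NNPP; intros Hn.
      assert (He : 0 < / (INR n + 1)).
      { apply Rinv_0_lt_compat; pose proof (pos_INR n); lra. }
      assert (m <= m - / (INR n + 1)); [|lra].
      apply Hlub; intros s [b [Hb ->]].
      apply Rnot_lt_le; intros Hlt; apply Hn; exists b; split; [exact Hb|lra]. }
    apply functional_choice in Hc; destruct Hc as [u Hu].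
    assert (Hm : m <= 0).
    { apply Hlub; intros s [b [_ ->]]; pose proof (sqd_ge0 x b); lra. }
    destruct (bounded_subseq_pt u (Rabs (fst x) + Rabs (snd x) + (1 - m) + 1))
      as [phi [l [Hphi [H1 H2]]]].
    { intros n; destruct (Hu n) as [_ Hn]; apply coord_bound_of_sqd.
      assert (/ (INR n + 1) <= 1).
      { rewrite <- Rinv_1 at 2; apply Rinv_le_contravar; pose proof (pos_INR n); lra. }
      lra. }
    exists l; split.
    + apply (HA (fun n => u (phi n))); auto; intros n; apply Hu.
    + intros b Hb.
      apply Rle_trans with (- m).
      * apply (lim_le (fun n => sqd x (u (phi n))) (fun n => - m + / (INR (phi n) + 1))).
        -- unfold sqd; simpl; lim.
        -- eapply lim_eq; [lim; exact (subseq_lim _ phi 0 Hphi lim_inv_S) | ring].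
        -- intros n; apply Hu.
      * assert (- sqd x b <= m); [|lra]; apply Hub; exists b; auto.
Qed.


(** * Tilting a touching free disk *)

(** The inequality is [r ^ 2 <= |z - (a + r w)| ^ 2] expanded for a unit vector [w], a form that
    passes easily to limits. *)
Definition supports (r : R) (A : pt -> Prop) (a w : pt) : Prop :=
  dot w w = 1 /\
  forall z, A z -> 2 * r * dot w (shift a z) <= sqd z a.

(** Normalised picture: the disk about [(r, 0)] touches at the origin and is tilted towards the
    second axis. If no direction [c / |c|] works, each tilted disk contains a point [q] of [F], and
    a limit [l] of these points has no place on the circle around [(r, 0)]. *)
Lemma tilted_support (r k delta : R) (F : pt -> Prop) :
  0 < r -> 0 < k -> 0 < delta ->
  seq_closed F ->
  (forall z, F z -> 2 * r * fst z <= fst z ^ 2 + snd z ^ 2) ->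
  (forall z, F z -> 0 < snd z -> - k * snd z <= fst z ->
             delta <= fst z ^ 2 + snd z ^ 2) ->
  (forall e, 0 < e -> exists c, r - e < fst c < r /\ 0 < snd c < e /\
     r ^ 2 <= fst c ^ 2 + snd c ^ 2 /\ forall z, F z -> r ^ 2 <= sqd z c) ->
  exists w, 0 < snd w /\ supports r F (0, 0) w.
Proof.
  intros Hr Hk Hdelta HF Hright Hnear Hc.
  apply NNPP; intros Hno.
  (* The three bounds ensure [r / 2 <= fst c], [snd c <= 1] and [snd c <= k * fst c]; the last one
     serves to put [q] into the wedge of [Hnear]. *)
  set (e0 := Rmin (r / 2) (Rmin 1 (k * r / 2))).
  assert (He0 : 0 < e0 /\ e0 <= r / 2 /\ e0 <= 1 /\ e0 <= k * r / 2).
  { unfold e0; repeat split.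
    - repeat apply Rmin_glb_lt; nra.
    - apply Rmin_l.
    - eapply Rle_trans; [apply Rmin_r | apply Rmin_l].
    - eapply Rle_trans; [apply Rmin_r | apply Rmin_r]. }
  destruct He0 as [He0 [He1 [He2 He3]]].
  (* The point [q] lies in the disk of radius [r] about [r c / |c|] but not in the one about [c], so
     it is nearer to the first centre. As [r <= |c|], this bounds [c.q] by [|c| ^ 2], which in the
     end excludes the antipode. *)
  assert (Hseq : forall n : nat, exists cq : pt * pt,
    let c := fst cq in let q := snd cq in
    (Rabs (fst c - r) <= / (INR n + 1) /\ Rabs (snd c - 0) <= / (INR n + 1)) /\
    (r / 2 <= fst c < r /\ 0 < snd c <= 1 /\ snd c <= k * fst c) /\
    r ^ 2 <= fst c ^ 2 + snd c ^ 2 /\ (forall z, F z -> r ^ 2 <= sqd z c) /\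
    F q /\ fst q ^ 2 + snd q ^ 2 < 2 * (fst c * fst q + snd c * snd q) /\
    fst c * fst q + snd c * snd q <= fst c ^ 2 + snd c ^ 2).
  { intros n.
    assert (He : 0 < / (INR n + 1)).
    { apply Rinv_0_lt_compat; pose proof (pos_INR n); lra. }
    destruct (Hc (Rmin e0 (/ (INR n + 1)))) as [c [Hc1 [Hc2 [Hc3 Hc4]]]].
    { apply Rmin_glb_lt; lra. }
    pose proof (Rmin_l e0 (/ (INR n + 1))); pose proof (Rmin_r e0 (/ (INR n + 1))).
    set (m := sqrt (fst c ^ 2 + snd c ^ 2)).
    assert (Hm : m * m = fst c ^ 2 + snd c ^ 2) by (apply sqrt_sqrt; nra).
    assert (Hm0 : 0 <= m) by apply sqrt_pos.
    assert (Hmr : r <= m) by nra.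
    assert (Hq : exists q, F q /\
      (fst q ^ 2 + snd q ^ 2) * m < 2 * r * (fst c * fst q + snd c * snd q)).
    { apply NNPP; intros Hq; apply Hno; exists (fst c / m, snd c / m); split.
      - simpl; apply Rdiv_lt_0_compat; lra.
      - split.
        + unfold dot; simpl.
          replace (fst c / m * (fst c / m) + snd c / m * (snd c / m))
            with ((fst c ^ 2 + snd c ^ 2) / (m * m)) by (field; lra).
          rewrite <- Hm; field; lra.
        + intros z Hz; apply Rnot_lt_le; intros Hlt; apply Hq; exists z; split; [exact Hz|].
          unfold sqd, dot in Hlt; simpl in Hlt.
          apply (Rmult_lt_compat_r m) in Hlt; [|lra].
          field_simplify in Hlt; [|lra]; field_simplify; lra. }
    destruct Hq as [q [Hq1 Hq2]].
    exists (c, q); simpl fst; simpl snd.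
    split; [split; rewrite ?Rminus_0_r; apply Rabs_le; lra|].
    split; [repeat split; try nra|].
    split; [exact Hc3|].
    split; [exact Hc4|].
    split; [exact Hq1|].
    specialize (Hc4 q Hq1); unfold sqd in Hc4.
    assert (Hqpos : 0 <= fst q ^ 2 + snd q ^ 2) by nra.
    split; [nra|].
    rewrite <- Hm.
    set (s := fst c * fst q + snd c * snd q) in *.
    set (Q := fst q ^ 2 + snd q ^ 2) in *.
    assert (Hs : r ^ 2 <= Q - 2 * s + m * m) by (unfold s, Q; rewrite Hm; lra).
    (* If [m^2 < s], then [m (Q - 2 s + m^2 - r^2) < (m - r) (m (m + r) - 2 s) <= 0]. *)
    apply Rnot_lt_le; intros Hlt.
    assert (m * (Q - 2 * s + m * m - r ^ 2) < (m - r) * (m * (m + r) - 2 * s)) by lra.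
    assert (0 <= m * (Q - 2 * s + m * m - r ^ 2)) by (apply Rmult_le_pos; lra).
    assert (m * r <= m * m) by (apply Rmult_le_compat_l; lra).
    assert (0 <= (m - r) * (2 * s - m * (m + r))) by (apply Rmult_le_pos; lra).
    lra. }
  apply functional_choice in Hseq; destruct Hseq as [cq Hcq].
  set (c := fun n => fst (cq n)); set (q := fun n => snd (cq n)).
  assert (Hb : forall n, Rabs (fst (q n)) <= Rabs r + 1 + Rabs 1 + ((r + 1) ^ 2) + 1 /\
                         Rabs (snd (q n)) <= Rabs r + 1 + Rabs 1 + ((r + 1) ^ 2) + 1).
  { intros n; destruct (Hcq n) as [_ [[H1 [H2 _]] [_ [_ [_ [H3 _]]]]]].
    fold (c n) (q n) in *.
    assert (Hs : sqd (c n) (q n) <= (r + 1) ^ 2).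
    { assert (fst (c n) ^ 2 <= r ^ 2) by nra; assert (snd (c n) ^ 2 <= 1) by nra.
      unfold sqd; nra. }
    apply coord_bound_of_sqd in Hs.
    rewrite (Rabs_pos_eq r), Rabs_R1 by lra.
    rewrite (Rabs_pos_eq (fst (c n))), (Rabs_pos_eq (snd (c n))) in Hs by lra.
    lra. }
  destruct (bounded_subseq_pt q _ Hb) as [phi [l [Hphi [Hl1 Hl2]]]].
  assert (Hc1 : is_lim_seq (fun n => fst (c (phi n))) r).
  { apply (subseq_lim (fun n => fst (c n)) phi r Hphi).
    apply lim_of_inv_S_bound; intros n; apply Hcq. }
  assert (Hc2 : is_lim_seq (fun n => snd (c (phi n))) 0).
  { apply (subseq_lim (fun n => snd (c n)) phi 0 Hphi).
    apply lim_of_inv_S_bound; intros n; apply Hcq. }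
  assert (HFl : F l).
  { apply (HF (fun n => q (phi n))); auto; intros n; apply Hcq. }
  assert (Hge : 2 * r * fst l <= fst l ^ 2 + snd l ^ 2) by now apply Hright.
  assert (Hle : fst l ^ 2 + snd l ^ 2 <= 2 * (r * fst l + 0 * snd l)).
  { apply (lim_le (fun n => fst (q (phi n)) ^ 2 + snd (q (phi n)) ^ 2)
                  (fun n => 2 * (fst (c (phi n)) * fst (q (phi n))
                                 + snd (c (phi n)) * snd (q (phi n))))).
    - simpl; lim.
    - lim.
    - intros n; apply Rlt_le, Hcq. }
  (* For [fst q >= 0], comparison with [Hright] and [fst c < r] forces [q] upwards; for [fst q < 0],
     the bound [snd c <= k * fst c] controls the slope. *)
  assert (Hup : forall n, 0 < snd (q n) /\ - k * snd (q n) <= fst (q n)).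
  { intros n; destruct (Hcq n) as [_ [[H1 [H2 H4]] [_ [_ [H5 [H3 _]]]]]].
    fold (c n) (q n) in *.
    pose proof (Hright _ H5) as H6.
    destruct (Rle_lt_dec 0 (fst (q n))) as [Hpos|Hneg].
    - assert (0 < snd (c n) * snd (q n)) by nra.
      assert (0 < snd (q n)) by nra; split; nra.
    - assert (- (fst (c n) * fst (q n)) < snd (c n) * snd (q n)) by nra.
      assert (0 < snd (q n)) by nra; split; [lra|].
      assert (snd (c n) * snd (q n) <= k * fst (c n) * snd (q n)) by nra.
      nra. }
  assert (Hl2pos : 0 <= snd l).
  { apply (lim_le (fun _ => 0) (fun n => snd (q (phi n)))); [lim|exact Hl2|].
    intros n; apply Rlt_le, Hup. }
  assert (Hl0 : delta <= fst l ^ 2 + snd l ^ 2).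
  { apply (lim_le (fun _ => delta) (fun n => fst (q (phi n)) ^ 2 + snd (q (phi n)) ^ 2)).
    - lim.
    - simpl; lim.
    - intros n; destruct (Hup (phi n)); apply Hnear; auto; apply Hcq. }
  (* [l] lies on the circle of radius [r] around [(r, 0)]; were it in the open upper half of
     it, the disks around the [c n] would swallow it. *)
  assert (Hl2neg : 2 * snd l <= (2 * fst l / r + 1) * 0).
  { apply (lim_le (fun _ => 2 * snd l) (fun n => (2 * fst l / r + 1) * snd (c (phi n))));
      [lim|lim|].
    intros n; destruct (Hcq (phi n)) as [_ [[H1 [H2 H4]] [H5 [H6 _]]]].
    fold (c (phi n)) in *; specialize (H6 l HFl); unfold sqd in H6.
    set (x := r - fst (c (phi n))) in *; set (y := snd (c (phi n))) in *.
    replace (fst (c (phi n))) with (r - x) in * by (unfold x; ring).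
    (* Since [r <= |c|], the inward displacement [x] of the centre is of second order in the
       sideways displacement [y]. *)
    assert (Hx : r * x <= y ^ 2) by nra.
    assert (Hxy : 2 * snd l * y <= 2 * fst l * x + y ^ 2) by nra.
    assert (Hfx : fst l * (r * x) <= fst l * y ^ 2) by (apply Rmult_le_compat_l; nra).
    assert (fst l * x <= fst l / r * y ^ 2).
    { apply (Rmult_le_reg_l r); [lra|].
      replace (r * (fst l / r * y ^ 2)) with (fst l * y ^ 2) by (field; lra); lra. }
    apply (Rmult_le_reg_r y); [lra|].
    unfold Rdiv in *; nra. }
  (* Only the origin and the antipode [(2 r, 0)] remain on the circle, and [Hl0] excludes the
     origin. *)
  assert (Hl20 : snd l = 0) by lra.
  assert (Hl1r : fst l = 2 * r) by (rewrite Hl20 in *; nra).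
  assert (Hend : r * fst l + 0 * snd l <= r ^ 2 + 0 ^ 2).
  { apply (lim_le (fun n => fst (c (phi n)) * fst (q (phi n))
                            + snd (c (phi n)) * snd (q (phi n)))
                  (fun n => fst (c (phi n)) ^ 2 + snd (c (phi n)) ^ 2)).
    - lim.
    - simpl; lim.
    - intros n; apply Hcq. }
  rewrite Hl1r in Hend; nra.
Qed.


(** The wedge is split by [x = k y]. Where [x <= k y], the condition on [k] gives
    [v1 x + v2 y >= v2 y / 2], and the second inequality bounds [y] from below; beyond, the first
    one bounds [x] from below. *)
Lemma wedge_free (r d k v1 v2 : R) :
  0 < r -> 0 < d -> 0 < k -> 0 < v2 -> 2 * k * Rabs v1 <= v2 ->
  exists delta, 0 < delta /\ forall x y,
    2 * r * x <= x ^ 2 + y ^ 2 -> 2 * d * (v1 * x + v2 * y) <= x ^ 2 + y ^ 2 ->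
    0 < y -> - k * y <= x -> delta <= x ^ 2 + y ^ 2.
Proof.
  intros Hr Hd Hk Hv2 Hkv.
  set (rho1 := 2 * r * k ^ 2 / (1 + k ^ 2)); set (rho2 := d * v2 / (1 + k ^ 2)).
  assert (Hk2 : 0 < 1 + k ^ 2) by nra.
  assert (H1 : 0 < rho1).
  { apply Rdiv_lt_0_compat; [|lra]; apply Rmult_lt_0_compat; nra. }
  assert (H2 : 0 < rho2) by (apply Rdiv_lt_0_compat; nra).
  exists (Rmin (rho1 ^ 2) (rho2 ^ 2)); split.
  { apply Rmin_glb_lt; nra. }
  intros x y Hx Hv Hy Hxy.
  destruct (Rle_lt_dec x (k * y)) as [Hle|Hlt].
  - apply Rle_trans with (rho2 ^ 2); [apply Rmin_r|].
    assert (Habs : Rabs x <= k * y) by (apply Rabs_le; lra).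
    assert (Hx2 : x ^ 2 <= (k * y) ^ 2) by (apply pow_maj_Rabs; exact Habs).
    assert (Hvx : - (v1 * x) <= Rabs v1 * (k * y)).
    { apply Rle_trans with (Rabs (v1 * x)).
      - rewrite <- Rabs_Ropp; apply Rle_abs.
      - rewrite Rabs_mult; apply Rmult_le_compat_l; [apply Rabs_pos|exact Habs]. }
    assert (Hlow : v2 * y <= 2 * (v1 * x + v2 * y)) by nra.
    assert (Hbig : d * v2 * y <= (1 + k ^ 2) * y * y) by nra.
    assert (rho2 <= y); [|nra].
    apply Rle_div_l; [lra|]; nra.
  - apply Rle_trans with (rho1 ^ 2); [apply Rmin_l|].
    assert (Hx0 : 0 < x) by nra.
    assert (Hky : (k * y) ^ 2 <= x ^ 2) by (apply pow_incr; nra).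
    assert (Hbig : 2 * r * k ^ 2 * x <= (1 + k ^ 2) * x * x) by nra.
    assert (rho1 <= x); [|nra].
    apply Rle_div_l; [lra|]; nra.
Qed.

(** * Orthonormal coordinates *)

Lemma dotC (p q : pt) : dot p q = dot q p.
Proof. unfold dot; ring. Qed.

(** In the plane, [u] is the quarter turn of [w] times the determinant [s], and [s * s = 1]. *)
Lemma frame_expand (w u p : pt) :
  dot w w = 1 -> dot u u = 1 -> dot w u = 0 ->
  p = (dot p w * fst w + dot p u * fst u, dot p w * snd w + dot p u * snd u).
Proof.
  destruct w as [w1 w2], u as [u1 u2], p as [p1 p2]; unfold dot; simpl; intros Hw Hu Hwu.
  set (s := w1 * u2 - w2 * u1).
  assert (Hu1 : u1 = - (s * w2)).
  { unfold s; replace u1 with (u1 * (w1 * w1 + w2 * w2)) at 1 by (rewrite Hw; ring).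
    replace (w2 * w2) with (1 - w1 * w1) by lra.
    replace (- ((w1 * u2 - w2 * u1) * w2))
      with (u1 * (w2 * w2) - w1 * (w1 * u1 + w2 * u2) + w1 * w1 * u1) by ring.
    rewrite Hwu; replace (w2 * w2) with (1 - w1 * w1) by lra; ring. }
  assert (Hu2 : u2 = s * w1).
  { unfold s; replace u2 with (u2 * (w1 * w1 + w2 * w2)) at 1 by (rewrite Hw; ring).
    replace ((w1 * u2 - w2 * u1) * w1)
      with (u2 * (w1 * w1) - w2 * (w1 * u1 + w2 * u2) + w2 * w2 * u2) by ring.
    rewrite Hwu; ring. }
  assert (Hs : s * s = 1).
  { rewrite Hu1, Hu2 in Hu.
    replace (s * s) with (s * s * (w1 * w1 + w2 * w2)) by (rewrite Hw; ring).
    rewrite <- Hu; ring. }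
  rewrite Hu1, Hu2; f_equal.
  - replace ((p1 * w1 + p2 * w2) * w1 + (p1 * - (s * w2) + p2 * (s * w1)) * - (s * w2))
      with ((p1 * w1 + p2 * w2) * w1 + (s * s) * (p1 * w2 - p2 * w1) * w2) by ring.
    rewrite Hs.
    replace ((p1 * w1 + p2 * w2) * w1 + 1 * (p1 * w2 - p2 * w1) * w2)
      with (p1 * (w1 * w1 + w2 * w2)) by ring.
    rewrite Hw; ring.
  - replace ((p1 * w1 + p2 * w2) * w2 + (p1 * - (s * w2) + p2 * (s * w1)) * (s * w1))
      with ((p1 * w1 + p2 * w2) * w2 + (s * s) * (p2 * w1 - p1 * w2) * w1) by ring.
    rewrite Hs.
    replace ((p1 * w1 + p2 * w2) * w2 + 1 * (p2 * w1 - p1 * w2) * w1)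
      with (p2 * (w1 * w1 + w2 * w2)) by ring.
    rewrite Hw; ring.
Qed.

Lemma frame_dot (w u p q : pt) :
  dot w w = 1 -> dot u u = 1 -> dot w u = 0 ->
  dot p q = dot p w * dot q w + dot p u * dot q u.
Proof.
  intros Hw Hu Hwu; rewrite (frame_expand w u p) at 1 by assumption.
  unfold dot; simpl; ring.
Qed.

Lemma sqd_shift (a p q : pt) : sqd p q = dot (shift a p) (shift a p)
  - 2 * dot (shift a p) (shift a q) + dot (shift a q) (shift a q).
Proof. unfold sqd, dot, shift; simpl; ring. Qed.

Lemma sqd_center (a p : pt) : sqd p a = dot (shift a p) (shift a p).
Proof. unfold sqd, dot, shift; simpl; ring. Qed.

(** * Free disks accumulating at a touching disk *)

Definition disk_complement_union (r : R) (A : pt -> Prop) : Prop :=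
  forall y, ~ A y -> exists c, sqd y c < r ^ 2 /\ forall z, A z -> r ^ 2 <= sqd z c.

(** Centres of free disks containing [a + t u] subconverge as [t] tends to [0], and the limit is at
    distance exactly [r] from [a] because [a] is in [A]. Containing [a + t u] but not [a] gives each
    centre a positive component along [u], whence [0 <= dot w u]. The approximating disks are
    returned as well, since tilting needs them. *)
Lemma limit_touching_disk (r t0 : R) (A : pt -> Prop) (a u : pt) :
  0 < r -> 0 < t0 -> A a -> disk_complement_union r A -> dot u u = 1 ->
  (forall t, 0 < t < t0 -> ~ A (fst a + t * fst u, snd a + t * snd u)) ->
  exists w, supports r A a w /\ 0 <= dot w u /\
    forall e, 0 < e -> exists c t,
      Rabs (fst c - (fst a + r * fst w)) < e /\ Rabs (snd c - (snd a + r * snd w)) < e /\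
      0 < t /\ sqd (fst a + t * fst u, snd a + t * snd u) c < r ^ 2 /\
      forall z, A z -> r ^ 2 <= sqd z c.
Proof.
  intros Hr Ht0 Ha HA Hu Hout.
  assert (Hseq : forall n : nat, exists tc : R * pt,
    let t := fst tc in let c := snd tc in
    0 < t <= 1 /\ Rabs (t - 0) <= / (INR n + 1) /\
    sqd (fst a + t * fst u, snd a + t * snd u) (fst a + fst c, snd a + snd c) < r ^ 2 /\
    forall z, A z -> r ^ 2 <= sqd z (fst a + fst c, snd a + snd c)).
  { intros n.
    assert (He : 0 < / (INR n + 1)).
    { apply Rinv_0_lt_compat; pose proof (pos_INR n); lra. }
    assert (/ (INR n + 1) <= 1).
    { rewrite <- Rinv_1 at 2; apply Rinv_le_contravar; pose proof (pos_INR n); lra. }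
    set (t := Rmin (t0 / 2) (/ (INR n + 1))).
    assert (Ht : 0 < t) by (apply Rmin_glb_lt; lra).
    assert (Ht1 : t <= t0 / 2) by apply Rmin_l.
    assert (Ht2 : t <= / (INR n + 1)) by apply Rmin_r.
    destruct (HA _ (Hout t ltac:(lra))) as [c [Hc1 Hc2]].
    exists (t, (fst c - fst a, snd c - snd a)); simpl.
    replace (fst a + (fst c - fst a)) with (fst c) by ring.
    replace (snd a + (snd c - snd a)) with (snd c) by ring.
    rewrite <- surjective_pairing.
    repeat split; auto; try lra.
    rewrite Rminus_0_r, Rabs_pos_eq; lra. }
  apply functional_choice in Hseq; destruct Hseq as [tc Htc].
  set (t := fun n => fst (tc n)); set (c := fun n => snd (tc n)).
  assert (Hexp : forall n, 0 < t n /\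
     t n ^ 2 - 2 * t n * dot (c n) u + dot (c n) (c n) < r ^ 2 /\ r ^ 2 <= dot (c n) (c n)).
  { intros n; destruct (Htc n) as [H1 [_ [H2 H3]]]; fold (t n) (c n) in *.
    specialize (H3 a Ha); split; [lra|].
    replace (t n ^ 2) with (t n ^ 2 * dot u u) by (rewrite Hu; ring).
    unfold sqd, dot in *; simpl fst in *; simpl snd in *; split; nra. }
  destruct (bounded_subseq_pt c (1 + 1 + r ^ 2 + 1)) as [phi [l [Hphi [Hl1 Hl2]]]].
  { intros n; destruct (Htc n) as [H1 [_ [H2 _]]]; fold (t n) (c n) in *.
    assert (Hs : sqd (t n * fst u, t n * snd u) (c n) <= r ^ 2).
    { unfold sqd in *; simpl in *; nra. }
    apply coord_bound_of_sqd in Hs; simpl fst in Hs; simpl snd in Hs.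
    assert (Rabs (t n * fst u) <= 1).
    { unfold dot in Hu; apply Rabs_le; nra. }
    assert (Rabs (t n * snd u) <= 1).
    { unfold dot in Hu; apply Rabs_le; nra. }
    lra. }
  assert (Ht : is_lim_seq (fun n => t (phi n)) 0).
  { apply (subseq_lim t phi 0 Hphi), lim_of_inv_S_bound; intros n; apply Htc. }
  assert (Hl : dot l l = r ^ 2).
  { apply Rle_antisym.
    - replace (dot l l) with (0 ^ 2 - 2 * 0 * dot l u + dot l l) by ring.
      apply (lim_le (fun n => t (phi n) ^ 2 - 2 * t (phi n) * dot (c (phi n)) u
                              + dot (c (phi n)) (c (phi n))) (fun _ => r ^ 2)).
      + unfold dot; simpl; lim.
      + lim.
      + intros n; apply Rlt_le, Hexp.
    - apply (lim_le (fun _ => r ^ 2) (fun n => dot (c (phi n)) (c (phi n)))).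
      + lim.
      + unfold dot; lim.
      + intros n; apply Hexp. }
  exists (fst l / r, snd l / r); split; [split|split].
  - replace (dot (fst l / r, snd l / r) (fst l / r, snd l / r)) with (dot l l / r ^ 2)
      by (unfold dot; simpl; field; lra).
    rewrite Hl; field; lra.
  - intros z Hz.
    replace (2 * r * dot (fst l / r, snd l / r) (shift a z))
      with (2 * dot l (shift a z)) by (unfold dot; simpl; field; lra).
    assert (r ^ 2 <= sqd z (fst a + fst l, snd a + snd l)).
    { apply (lim_le (fun _ => r ^ 2)
               (fun n => sqd z (fst a + fst (c (phi n)), snd a + snd (c (phi n))))).
      - lim.
      - unfold sqd; simpl; lim.
      - intros n; apply Htc, Hz. }
    unfold sqd, dot in *; simpl in *; nra.
  - assert (0 <= dot l u).
    { apply (lim_le (fun _ => 0) (fun n => dot (c (phi n)) u)); [lim|unfold dot; lim|].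
      intros n; destruct (Hexp (phi n)) as [H1 [H2 H3]].
      assert (0 < 2 * t (phi n) * dot (c (phi n)) u) by nra; nra. }
    replace (dot (fst l / r, snd l / r) u) with (dot l u / r)
      by (unfold dot; simpl; field; lra).
    apply Rle_mult_inv_pos; lra.
  - intros e He.
    apply is_lim_seq_spec in Hl1; apply is_lim_seq_spec in Hl2.
    destruct (Hl1 (mkposreal e He)) as [N1 HN1]; destruct (Hl2 (mkposreal e He)) as [N2 HN2].
    set (n := max N1 N2).
    specialize (HN1 n (Nat.le_max_l _ _)); specialize (HN2 n (Nat.le_max_r _ _)).
    exists (fst a + fst (c (phi n)), snd a + snd (c (phi n))), (t (phi n)).
    simpl in *.
    replace (fst a + fst (c (phi n)) - (fst a + r * (fst l / r)))
      with (fst (c (phi n)) - fst l) by (field; lra).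
    replace (snd a + snd (c (phi n)) - (snd a + r * (snd l / r)))
      with (snd (c (phi n)) - snd l) by (field; lra).
    repeat split; auto; apply Htc.
Qed.


(** * Supporting directions in front of a proximal normal *)

Definition frame (a w u z : pt) : pt :=
  (fst a + fst z * fst w + snd z * fst u, snd a + fst z * snd w + snd z * snd u).

(** The limit disk along the ray in direction [u] serves unless [dot w u = 0]. In that case
    [tilted_support] applies in the frame [(w, u)], with the wedge cleared by the inequalities for
    [w] and [v]. *)
Lemma support_in_front (r d : R) (A : pt -> Prop) (a v u : pt) :
  0 < r -> 0 < d -> seq_closed A -> A a -> disk_complement_union r A ->
  (forall z, A z -> 2 * d * dot v (shift a z) <= sqd z a) ->
  dot u u = 1 -> 0 < dot v u ->
  exists w, supports r A a w /\ 0 < dot w u.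
Proof.
  intros Hr Hd HA Ha Hun Hv Hu Hvu.
  (* At [a + t u] the inequality [Hv] would require [2 d (v.u) <= t], which fixes this length. *)
  destruct (limit_touching_disk r (2 * d * dot v u) A a u) as [w [[Hw Hsup] [Hwu Happ]]];
    auto.
  { nra. }
  { intros t Ht Hin; specialize (Hv _ Hin).
    assert (Htt : 2 * d * (t * dot v u) <= t ^ 2 * dot u u).
    { unfold sqd, dot, shift in *; simpl in *; nra. }
    rewrite Hu in Htt; nra. }
  destruct (Rle_lt_or_eq_dec _ _ Hwu) as [Hpos|H0].
  { exists w; repeat split; auto. }
  symmetry in H0; clear Hwu.
  set (F := fun z => A (frame a w u z)).
  assert (Hshift : forall z, shift a (frame a w u z) =
            (fst z * fst w + snd z * fst u, fst z * snd w + snd z * snd u)).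
  { intros z; unfold shift, frame; simpl; f_equal; ring. }
  assert (Hfw : forall z, dot w (shift a (frame a w u z)) = fst z).
  { intros z; rewrite Hshift.
    transitivity (fst z * dot w w + snd z * dot w u); [unfold dot; simpl; ring|].
    rewrite Hw, H0; ring. }
  assert (Hfu : forall z, dot u (shift a (frame a w u z)) = snd z).
  { intros z; rewrite Hshift.
    transitivity (fst z * dot w u + snd z * dot u u); [unfold dot; simpl; ring|].
    rewrite Hu, H0; ring. }
  assert (Hdot : forall p z, dot p (shift a (frame a w u z)) = dot p w * fst z + dot p u * snd z).
  { intros p z; rewrite Hshift; unfold dot; simpl; ring. }
  assert (Hsq : forall z, sqd (frame a w u z) a = fst z ^ 2 + snd z ^ 2).
  { intros z.
    transitivity (fst z ^ 2 * dot w w + 2 * fst z * snd z * dot w u + snd z ^ 2 * dot u u).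
    - unfold sqd, frame, dot; simpl; ring.
    - rewrite Hw, Hu, H0; ring. }
  (* [wedge_free] asks for [2 k |v.w| <= v.u]; the added [1] covers [v.w = 0]. *)
  set (k := dot v u / (2 * (Rabs (dot v w) + 1))).
  pose proof (Rabs_pos (dot v w)) as Habs.
  assert (Hk : 0 < k) by (apply Rdiv_lt_0_compat; lra).
  destruct (wedge_free r d k (dot v w) (dot v u)) as [delta [Hdelta Hwedge]]; auto.
  { assert (k * (2 * (Rabs (dot v w) + 1)) = dot v u) by (unfold k; field; lra); nra. }
  destruct (tilted_support r k delta F) as [x [Hx2 [Hx Hxs]]]; auto.
  - intros s l Hs H1 H2; apply (HA (fun n => frame a w u (s n))); auto;
      unfold frame; simpl; lim.
  - intros z Hz; specialize (Hsup _ Hz).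
    rewrite Hfw, Hsq in Hsup; exact Hsup.
  - intros z Hz Hz2 Hz1; apply Hwedge; auto.
    + specialize (Hsup _ Hz).
      rewrite Hfw, Hsq in Hsup; exact Hsup.
    + specialize (Hv _ Hz); rewrite Hdot, Hsq in Hv; exact Hv.
  (* Errors below [e / 2] in the original coordinates of a centre stay below [e] in the frame. As
     the disk contains [a + t u] but not [a], the centre has positive [u] coordinate and [w]
     coordinate below [r]. *)
  - intros e He.
    assert (Hbw : Rabs (fst w) <= 1 /\ Rabs (snd w) <= 1).
    { unfold dot in Hw; split; apply Rabs_le; nra. }
    assert (Hbu : Rabs (fst u) <= 1 /\ Rabs (snd u) <= 1).
    { unfold dot in Hu; split; apply Rabs_le; nra. }
    destruct (Happ (e / 2)) as [c [t [Hc1 [Hc2 [Ht [Hc3 Hc4]]]]]]; [lra|].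
    set (e1 := fst c - (fst a + r * fst w)) in *.
    set (e2 := snd c - (snd a + r * snd w)) in *.
    assert (Hprod : forall x y b1 b2, Rabs x < e / 2 -> Rabs y < e / 2 ->
              Rabs b1 <= 1 -> Rabs b2 <= 1 -> Rabs (x * b1 + y * b2) < e).
    { intros x y b1 b2 Hx Hy Hb1 Hb2.
      eapply Rle_lt_trans; [apply Rabs_triang|].
      rewrite !Rabs_mult.
      pose proof (Rabs_pos x); pose proof (Rabs_pos y); nra. }
    assert (Hcw : dot (shift a c) w = r + (e1 * fst w + e2 * snd w)).
    { transitivity (r * dot w w + (e1 * fst w + e2 * snd w)).
      - unfold e1, e2, dot, shift; simpl; ring.
      - rewrite Hw; ring. }
    assert (Hcu : dot (shift a c) u = e1 * fst u + e2 * snd u).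
    { transitivity (r * dot w u + (e1 * fst u + e2 * snd u)).
      - unfold e1, e2, dot, shift; simpl; ring.
      - rewrite H0; ring. }
    assert (Hew := Hprod e1 e2 (fst w) (snd w) Hc1 Hc2 (proj1 Hbw) (proj2 Hbw)).
    assert (Heu := Hprod e1 e2 (fst u) (snd u) Hc1 Hc2 (proj1 Hbu) (proj2 Hbu)).
    rewrite <- Hcu in Heu.
    apply Rabs_def2 in Hew; apply Rabs_def2 in Heu.
    assert (Hcc : dot (shift a c) (shift a c)
                  = dot (shift a c) w ^ 2 + dot (shift a c) u ^ 2).
    { rewrite (frame_dot w u) at 1 by assumption; ring. }
    assert (Hca : r ^ 2 <= dot (shift a c) w ^ 2 + dot (shift a c) u ^ 2).
    { rewrite <- Hcc; specialize (Hc4 a Ha); unfold sqd, dot, shift in *; simpl in *; nra. }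
    assert (Hct : dot (shift a c) w ^ 2 + (dot (shift a c) u - t) ^ 2 < r ^ 2).
    { replace (dot (shift a c) w ^ 2 + (dot (shift a c) u - t) ^ 2)
        with (dot (shift a c) w ^ 2 + dot (shift a c) u ^ 2
              - 2 * t * dot (shift a c) u + t ^ 2 * 1) by ring.
      rewrite <- Hcc, <- Hu; unfold sqd, dot, shift in *; simpl in *; nra. }
    exists (dot (shift a c) w, dot (shift a c) u); simpl fst; simpl snd.
    assert (0 < dot (shift a c) u) by nra.
    assert (dot (shift a c) w < r).
    { pose proof (pow2_ge_0 (dot (shift a c) u - t)).
      apply Rnot_le_lt; intros Hle; pose proof (pow_incr r _ 2 (conj (Rlt_le _ _ Hr) Hle)).
      lra. }
    repeat split; try lra.
    intros z Hz; specialize (Hc4 _ Hz).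
    rewrite (sqd_shift a), Hcc, <- sqd_center, Hsq in Hc4.
    rewrite (dotC (shift a (frame _ _ _ _))), Hdot in Hc4.
    unfold sqd; simpl fst; simpl snd; lra.
  - exists (fst x * fst w + snd x * fst u, fst x * snd w + snd x * snd u).
    split; [split|].
    + transitivity (fst x ^ 2 * dot w w + 2 * fst x * snd x * dot w u + snd x ^ 2 * dot u u).
      * unfold dot; simpl; ring.
      * rewrite Hw, Hu, H0; unfold dot in Hx; lra.
    + intros z Hz.
      set (z' := (dot (shift a z) w, dot (shift a z) u)).
      assert (Hz' : frame a w u z' = z).
      { pose proof (frame_expand w u (shift a z) Hw Hu H0) as He.
        assert (He1 := f_equal fst He); assert (He2 := f_equal snd He).
        simpl fst in *; simpl snd in *.
        unfold frame, z'; simpl fst; simpl snd.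
        destruct z as [z1 z2]; simpl in He1, He2; f_equal; simpl fst in *; simpl snd in *; lra. }
      assert (HF' : F z') by (unfold F; rewrite Hz'; exact Hz).
      specialize (Hxs _ HF').
      rewrite <- Hz', Hsq, Hdot.
      unfold sqd in Hxs; simpl (fst (0, 0)) in Hxs; simpl (snd (0, 0)) in Hxs.
      rewrite !Rminus_0_r in Hxs.
      replace (dot (fst x * fst w + snd x * fst u, fst x * snd w + snd x * snd u) w)
        with (fst x * dot w w + snd x * dot w u) by (unfold dot; simpl; ring).
      replace (dot (fst x * fst w + snd x * fst u, fst x * snd w + snd x * snd u) u)
        with (fst x * dot w u + snd x * dot u u) by (unfold dot; simpl; ring).
      rewrite Hw, Hu, H0; unfold dot in Hxs; simpl fst in *; simpl snd in *; lra.
    + replace (dot (fst x * fst w + snd x * fst u, fst x * snd w + snd x * snd u) u)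
        with (fst x * dot w u + snd x * dot u u) by (unfold dot; simpl; ring).
      rewrite Hu, H0; lra.
Qed.


(** * Separation of a direction from the normal cone *)

Lemma supports_seq_closed (r : R) (A : pt -> Prop) (a : pt) : seq_closed (supports r A a).
Proof.
  intros w l Hw H1 H2; split.
  - apply Rle_antisym.
    + apply (lim_le (fun n => dot (w n) (w n)) (fun _ => 1)); [unfold dot; lim|lim|].
      intros n; apply Req_le, Hw.
    + apply (lim_le (fun _ => 1) (fun n => dot (w n) (w n))); [lim|unfold dot; lim|].
      intros n; apply Req_le; symmetry; apply Hw.
  - intros z Hz.
    apply (lim_le (fun n => 2 * r * dot (w n) (shift a z))
                  (fun _ => sqd z a)); [unfold dot; simpl; lim|lim|].
    intros n; apply Hw, Hz.
Qed.

(** Spherical convexity for pairs of vectors; closedness is meant algebraically, not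
    topologically. *)
Definition cone_closed (N : pt -> Prop) : Prop :=
  forall w1 w2 s1 s2 w, N w1 -> N w2 -> 0 <= s1 -> 0 <= s2 ->
  w = padd (pscale s1 w1) (pscale s2 w2) -> dot w w = 1 -> N w.

(** Were [x] on the side of [u], either [v] would lie between [w] and [x], hence in the cone they
    span, or [x] would lie strictly between [w] and [v], making [dot v x] exceed the maximum. *)
Lemma unit_max_separates (N : pt -> Prop) (v w u : pt) :
  (forall x, N x -> dot x x = 1) -> cone_closed N -> dot v v = 1 -> ~ N v ->
  N w -> (forall x, N x -> dot v x <= dot v w) -> 0 < dot v w ->
  dot u u = 1 -> dot w u = 0 -> 0 < dot v u ->
  forall x, N x -> dot x u <= 0.
Proof.
  intros Hunit Hcone Hv HNv HNw Hmax Hvw Hu Hwu Hvu x Hx.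
  assert (Hw : dot w w = 1) by auto.
  apply Rnot_lt_le; intros Hxu.
  destruct (Rle_lt_dec (dot x w * dot v u) (dot v w * dot x u)) as [Hle|Hlt].
  - apply HNv.
    apply (Hcone x w (dot v u / dot x u) (dot v w - dot v u / dot x u * dot x w)); auto.
    + apply Rle_mult_inv_pos; lra.
    + apply Rle_minus_r; rewrite Rplus_0_l.
      replace (dot v u / dot x u * dot x w) with (dot x w * dot v u / dot x u)
        by (field; lra).
      apply Rle_div_l; lra.
    + rewrite (frame_expand w u v) at 1 by assumption.
      pose proof (frame_expand w u x Hw Hu Hwu) as Hexp.
      set (x1 := dot x w) in *; set (x2 := dot x u) in *; clearbody x1 x2.
      rewrite Hexp; unfold padd, pscale; simpl; f_equal; field; lra.
  - specialize (Hmax x Hx); specialize (Hunit x Hx).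
    rewrite (frame_dot w u v x) in Hmax by assumption.
    rewrite (frame_dot w u x x) in Hunit by assumption.
    set (x1 := dot x w) in *; set (x2 := dot x u) in *.
    set (v1 := dot v w) in *; set (v2 := dot v u) in *.
    assert (Hx1 : 0 < x1) by nra.
    assert (H1 : x2 * x2 = (1 - x1) * (1 + x1)) by lra.
    assert (H2 : v2 * x2 <= v1 * (1 - x1)) by lra.
    (* The factor [1 + x1] turns [1 - x1] into [x2 * x2], after which one [x2] cancels. *)
    assert (H3 : v2 * x2 * (1 + x1) <= v1 * (x2 * x2)).
    { rewrite H1; nra. }
    assert (H4 : v2 * (1 + x1) <= v1 * x2) by nra.
    nra.
Qed.

(** Enlarges the radius of a normal from [d] to [r]. The supporting [w] nearest to [v] maximises
    [dot v w]; if it differs from [v], no support has a positive component along the normal [u] to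
    [w] on the side of [v], against [support_in_front]. *)
Lemma proximal_normal_supports (r d : R) (A : pt -> Prop) (a v : pt) :
  0 < r -> 0 < d -> seq_closed A -> A a -> disk_complement_union r A ->
  cone_closed (supports r A a) ->
  dot v v = 1 -> (forall z, A z -> 2 * d * dot v (shift a z) <= sqd z a) ->
  supports r A a v.
Proof.
  intros Hr Hd HA Ha Hun Hcone Hv Hprox; apply NNPP; intros HNv.
  assert (Hfront : forall u, dot u u = 1 -> 0 < dot v u ->
                   exists w, supports r A a w /\ 0 < dot w u).
  { intros u Hu Hvu; now apply (support_in_front r d A a v u). }
  destruct (Hfront v Hv ltac:(lra)) as [w0 [Hw0 Hw0v]].
  destruct (nearest_exists (supports r A a) v) as [w [Hw Hnear]].
  { now exists w0. }
  { apply supports_seq_closed. }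
  assert (Hmax : forall x, supports r A a x -> dot v x <= dot v w).
  { intros x Hx; specialize (Hnear x Hx); destruct Hx as [Hx _], Hw as [Hww _].
    unfold sqd, dot in *; nra. }
  assert (Hvw : 0 < dot v w) by (specialize (Hmax w0 Hw0); rewrite dotC in Hw0v; lra).
  assert (Hww := proj1 Hw).
  set (s := dot v (- snd w, fst w)).
  assert (Hs : dot v w ^ 2 + s ^ 2 = 1).
  { transitivity (dot v v * dot w w); [unfold s, dot; simpl; ring|rewrite Hv, Hww; ring]. }
  (* The sign [g] selects the quarter turn of [w] on the side of [v]. *)
  set (g := if Rle_dec 0 s then 1 else -1).
  assert (Hg : g * g = 1 /\ 0 <= g * s) by (unfold g; destruct Rle_dec; split; lra).
  set (u := (g * - snd w, g * fst w)).
  assert (Hu : dot u u = 1).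
  { transitivity (g * g * dot w w); [unfold u, dot; simpl; ring|].
    rewrite Hww; lra. }
  assert (Hwu : dot w u = 0) by (unfold u, dot; simpl; ring).
  assert (Hvu : dot v u = g * s) by (unfold u, s, dot; simpl; ring).
  destruct (Rle_lt_or_eq_dec _ _ (proj2 Hg)) as [Hpos|H0].
  - destruct (Hfront u Hu ltac:(lra)) as [x [Hx Hxu]].
    assert (dot x u <= 0); [|lra].
    apply (unit_max_separates (supports r A a) v w u); auto; [|lra].
    intros y Hy; apply Hy.
  - apply HNv; replace v with w; [exact Hw|].
    assert (s = 0) by nra.
    assert (dot v w = 1) by nra.
    rewrite (frame_expand w u v) by assumption.
    rewrite Hvu, <- H0, H1; destruct w; simpl; f_equal; ring.
Qed.

(** * From spherical convexity to unique nearest points *)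

Lemma sph_convex_cone_closed (K : pt -> Prop) :
  sph_convex K -> cone_closed K.
Proof.
  intros HK w1 w2 s1 s2 w H1 H2 Hs1 Hs2 -> Hw.
  apply (proj1 (HK _)); split.
  - intros C HC Hsub.
    (* The midpoint of the doubled vectors is a convex combination that avoids division by
       [s1 + s2]. *)
    replace (padd (pscale s1 w1) (pscale s2 w2))
      with (padd (pscale (1 / 2) (pscale (2 * s1) w1))
                 (pscale (1 - 1 / 2) (pscale (2 * s2) w2)))
      by (unfold padd, pscale; simpl; f_equal; field).
    apply HC; [| |lra]; apply Hsub.
    + exists (2 * s1), w1; repeat split; auto; lra.
    + exists (2 * s2), w2; repeat split; auto; lra.
  - unfold S1, dist2, origin; simpl fst; simpl snd.
    rewrite !Rminus_0_r; rewrite <- sqrt_1; f_equal.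
    rewrite <- Hw; unfold dot; simpl; ring.
Qed.

Lemma normal_cone_R_supports (r : R) (A : pt -> Prop) (a v : pt) :
  0 < r -> normal_cone_R r A a v <-> supports r A a v.
Proof.
  intros Hr; unfold normal_cone_R, supports, S1.
  assert (Hunit : dist2 v origin = 1 <-> dot v v = 1).
  { unfold dist2, origin; simpl fst; simpl snd; rewrite !Rminus_0_r.
    replace (fst v ^ 2 + snd v ^ 2) with (dot v v) by (unfold dot; ring).
    split; intros H; [|rewrite H; apply sqrt_1].
    assert (0 <= dot v v) by (unfold dot; nra).
    rewrite <- (sqrt_sqrt (dot v v)), H by assumption; ring. }
  rewrite Hunit.
  assert (Hexp : forall z, dot v v = 1 -> sqd z (padd a (pscale r v)) =
     sqd z a - 2 * r * dot v (shift a z) + r ^ 2).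
  { intros z Hv; transitivity (sqd z a - 2 * r * dot v (shift a z)
      + r ^ 2 * dot v v); [unfold sqd, dot; simpl; ring|rewrite Hv; ring]. }
  unfold disk; split; intros [Hv H]; split; auto; intros z.
  - intros Hz; apply Rnot_lt_le; intros Hlt; apply (H z); [|exact Hz].
    apply dist2_sqd_lt; auto; rewrite Hexp by assumption; lra.
  - intros Hlt Hz; apply dist2_sqd_lt in Hlt; auto.
    rewrite Hexp in Hlt by assumption; specialize (H z Hz); lra.
Qed.

Lemma R_body_disk_complement_union (r : R) (A : pt -> Prop) :
  0 < r -> is_R_body r A -> disk_complement_union r A.
Proof.
  intros Hr [_ HA] y Hy; destruct (HA y Hy) as [c [Hc Hfree]].
  exists c; split; [now apply dist2_sqd_lt|].
  intros z Hz; apply Rnot_lt_le; intros Hlt; apply (Hfree z); [|exact Hz].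
  now apply dist2_sqd_lt.
Qed.

Lemma sqd_eq0 (p q : pt) : sqd p q = 0 -> p = q.
Proof.
  destruct p as [p1 p2], q as [q1 q2]; unfold sqd; simpl fst; simpl snd.
  rewrite <- !Rsqr_pow2; intros H; apply Rplus_sqr_eq_0 in H; f_equal; lra.
Qed.

(** The direction from a nearest point [a] to [x] is a normal of radius [d < r]. Once it is enlarged
    to [r], the closed disk of radius [d] about [x] meets the circle of the free disk only at
    [a]. *)
Lemma Unp_of_near (r : R) (A : pt -> Prop) (x b : pt) :
  0 < r -> is_R_body r A ->
  (forall a, boundary A a -> sph_convex (normal_cone_R r A a)) ->
  A b -> dist2 x b < r -> Unp A x.
Proof.
  intros Hr HA Hconv Hb Hxb.
  pose proof (R_body_disk_complement_union r A Hr HA) as Hun.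
  destruct HA as [[_ Hcl] _]; apply closed_seq_closed in Hcl.
  destruct (nearest_exists A x) as [a [Ha Hmin]]; [now exists b|exact Hcl|].
  apply dist2_sqd_lt in Hxb; [|exact Hr].
  assert (Hxa : sqd x a < r ^ 2) by (specialize (Hmin b Hb); lra).
  exists a; split; [split; [exact Ha|intros y Hy; apply dist2_sqd_le; auto]|].
  intros y [Hy Hymin].
  assert (Hya : sqd x y <= sqd x a) by (apply dist2_sqd_le; auto).
  set (d := sqrt (sqd x a)).
  assert (Hd : d * d = sqd x a) by apply sqrt_sqrt, sqd_ge0.
  assert (Hd0 : 0 <= d) by apply sqrt_pos.
  (* For [d = 0] there is no direction to normalise, but then [a] and [y] both equal [x]. *)
  destruct (Rle_lt_or_eq_dec _ _ Hd0) as [Hdpos|Hd00].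
  2: { rewrite <- Hd00 in Hd; pose proof (sqd_ge0 x y).
       transitivity x; [symmetry|]; apply sqd_eq0; lra. }
  set (v := (fst (shift a x) / d, snd (shift a x) / d)).
  assert (Hv : dot v v = 1).
  { transitivity (sqd x a / (d * d)); [|rewrite <- Hd; field; lra].
    unfold v, dot, sqd, shift; simpl; field; lra. }
  assert (Hdv : forall z, d * dot v (shift a z) = dot (shift a x) (shift a z)).
  { intros z; unfold v, dot; simpl; field; lra. }
  assert (Hprox : forall z, A z -> 2 * d * dot v (shift a z) <= sqd z a).
  { intros z Hz; specialize (Hmin z Hz).
    rewrite Rmult_assoc, Hdv; unfold sqd, dot, shift in *; simpl in *; nra. }
  (* Convexity is available at boundary points; for [0 < t < d] the point [a + t v] is nearer to [x]
     than [a], hence outside [A]. *)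
  assert (Hbd : boundary A a).
  { intros e He; split.
    - exists a; split; [|exact Ha].
      apply dist2_sqd_lt; [exact He|]; unfold sqd; nra.
    - set (t := Rmin d e / 2).
      assert (Ht : 0 < t) by (unfold t; pose proof (Rmin_glb_lt d e 0); lra).
      assert (Htd : t < d) by (unfold t in *; pose proof (Rmin_l d e); lra).
      assert (Hte : t < e) by (unfold t in *; pose proof (Rmin_r d e); lra).
      exists (padd a (pscale t v)).
      assert (Hta : sqd (padd a (pscale t v)) a = t ^ 2).
      { transitivity (t ^ 2 * dot v v); [unfold sqd, dot; simpl; ring|rewrite Hv; ring]. }
      split; [apply dist2_sqd_lt; [exact He|]; rewrite Hta; nra|].
      intros Hin; specialize (Hprox _ Hin); rewrite Hta in Hprox.
      replace (dot v (shift a (padd a (pscale t v)))) with (t * dot v v) in Hprox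
        by (unfold dot, shift; simpl; ring).
      rewrite Hv in Hprox; nra. }
  assert (Hcone : cone_closed (supports r A a)).
  { intros w1 w2 s1 s2 w H1 H2 Hs1 Hs2 Hw Hu.
    apply normal_cone_R_supports; [exact Hr|].
    apply (sph_convex_cone_closed _ (Hconv a Hbd) w1 w2 s1 s2); auto;
      now apply normal_cone_R_supports. }
  assert (Hsup : supports r A a v) by now apply (proximal_normal_supports r d A a v).
  destruct Hsup as [_ Hsup]; specialize (Hsup y Hy).
  (* Both [|y - a|^2 <= 2 d v.(y - a)] and [2 r v.(y - a) <= |y - a|^2], while [d < r]. *)
  assert (Hyle : sqd y a <= 2 * d * dot v (shift a y)).
  { rewrite Rmult_assoc, Hdv; unfold sqd, dot, shift in *; simpl in *; nra. }
  pose proof (sqd_ge0 y a).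
  assert (d < r) by nra.
  set (p := dot v (shift a y)) in *.
  assert (0 <= p) by nra.
  assert (p <= 0) by nra.
  apply sqd_eq0; assert (p = 0) by lra; nra.
Qed.

Theorem mainTheorem19 (r : R) (A : pt -> Prop) :
  0 < r ->
  is_R_body r A ->
  (forall a, boundary A a -> sph_convex (normal_cone_R r A a)) ->
  Rbar_le (Finite r) (reach A).
Proof.
  intros Hr HA Hconv; unfold reach.
  apply (proj2_sig (Rbar_ex_glb _)); intros s [a [Ha ->]].
  (* The radius [r] itself is admissible in the supremum at each [a] in [A]. *)
  apply Lub_Rbar_correct; split; [exact Hr|].
  intros x Hx; now apply (Unp_of_near r A x a).
Qed.
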